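(* For every $n\ge1$, $$\sum_{\sigma\in B_n}q^{\operatorname{nden}(\sigma)}t^{\operatorname{exc}_{\mathrm{abs}}(\sigma)}=\sum_{\sigma\in B_n}q^{\operatorname{fmaj}(\sigma)}t^{\operatorname{fdes}(\sigma)}.$$
   Context: $B_n$ is the group of signed permutations: bijections $\sigma$ of $\{-n,\dots,n\}$ with $\sigma(-i)=-\sigma(i)$, written in window notation $\sigma(1)\cdots\sigma(n)$. Using the usual order on integers, $\operatorname{Des}(\sigma)=\{i\in[n-1]:\sigma(i)>\sigma(i+1)\}$, $\operatorname{des}(\sigma)=|\operatorname{Des}(\sigma)|$, $\operatorname{maj}(\sigma)=\sum_{i\in\operatorname{Des}(\sigma)}i$, and $\operatorname{neg}(\sigma)=|\{i\in[n]:\sigma(i)<0\}|$. The flag statistics are $\operatorname{fdes}(\sigma)=2\operatorname{des}(\sigma)+\chi(\sigma(1)<0)$ (where $\chi(\sigma(1)<0)$ is $1$ if $\sigma(1)<0$ and $0$ otherwise) and $\operatorname{fmaj}(\sigma)=2\operatorname{maj}(\sigma)+\operatorname{neg}(\sigma)$. Let $|\sigma|=|\sigma(1)|\cdots|\sigma(n)|\in S_n$. For $\pi\in S_n$ (viewed as a word $\pi_1\cdots\pi_n$): $\operatorname{Exc}(\pi)=\{i:\pi_i>i\}$, $\operatorname{exc}(\pi)=|\operatorname{Exc}(\pi)|$; $E(\pi)$ (resp. $N(\pi)$) is the subword of letters in positions in $\operatorname{Exc}(\pi)$ (resp. not in $\operatorname{Exc}(\pi)$), in increasing order of position; for a word $u$,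 $\operatorname{inv}(u)=|\{(i,j):i<j,u_i>u_j\}|$ and $\operatorname{imv}(u)=|\{(i,j):i<j,u_i\ge u_j\}|$; and $\operatorname{den}_H(\pi)=\sum_{i\in\operatorname{Exc}(\pi)}i+\operatorname{imv}(E(\pi))+\operatorname{inv}(N(\pi))$. Define $\operatorname{exc}_{\mathrm{abs}}(\sigma)=\operatorname{exc}(|\sigma|)+\operatorname{neg}(\sigma)$ and $\operatorname{nden}(\sigma)=\operatorname{den}_H(|\sigma|)-\sum_{i:\sigma(i)<0}\sigma(i)$. *)

(* Defs.v *)
From HB Require Import structures.
From mathcomp Require Import all_boot all_order all_algebra all_fingroup.

Set Implicit Arguments.
Unset Strict Implicit.
Unset Printing Implicit Defensive.

Import Order.TTheory GRing.Theory Num.Theory.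
Local Open Scope ring_scope.

(* The set {-n, ..., n} is represented by 'I_(n.*2.+1): the ordinal j stands
   for the integer j - n. *)
Definition ord_int n (j : 'I_n.*2.+1) : int := j%:Z - n%:Z.

(* Inverse of ord_int; only meaningful for -n <= k <= n. *)
Definition int_ord n (k : int) : 'I_n.*2.+1 := inord `|(k + n%:Z)%R|%N.

Lemma ord_intK n : cancel (@ord_int n) (@int_ord n).
Proof. by move=> j; rewrite /int_ord /ord_int subrK absz_nat inord_val. Qed.

Lemma int_ordK n (k : int) : - n%:Z <= k <= n%:Z -> ord_int (int_ord n k) = k.
Proof.
case/andP=> ge_k le_k; have k_ge0 : 0 <= k + n%:Z by rewrite -lerBlDr sub0r.
rewrite /ord_int inordK; first by rewrite gez0_abs // addrK.
by rewrite ltnS -lez_nat gez0_abs // -addnn PoszD lerD2r.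
Qed.

(* rev_ord is the map k |-> -k of {-n, ..., n}. *)
Lemma ord_int_rev n (j : 'I_n.*2.+1) : ord_int (rev_ord j) = - ord_int j.
Proof.
have le_j : (j <= n.*2)%N by rewrite -ltnS.
have dE : n.*2%:Z = n%:Z + n%:Z by rewrite -addnn PoszD.
by rewrite /ord_int /= subSS -subzn // dE opprB addrAC addrK.
Qed.

Record signed_perm (n : nat) := SignedPerm {
  sperm_val :> {perm 'I_n.*2.+1};
  spermP : [forall j, sperm_val (rev_ord j) == rev_ord (sperm_val j)]
}.

HB.instance Definition _ n := [isSub for @sperm_val n].
HB.instance Definition _ n := [Finite of signed_perm n by <:].

Notation "''B_' n" := (signed_perm n)
  (at level 8, n at level 2, format "''B_' n") : type_scope.

(* The integer sigma(k), for -n <= k <= n. *)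
Definition sapp n (s : 'B_n) (k : int) : int := ord_int (s (int_ord n k)).

Lemma sappN n (s : 'B_n) (k : int) :
  - n%:Z <= k <= n%:Z -> sapp s (- k) = - sapp s k.
Proof.
move=> k_n; rewrite /sapp -ord_int_rev -(eqP (forallP (spermP s) _)).
congr (ord_int (s _)); apply: (can_inj (@ord_intK n)).
rewrite ord_int_rev !int_ordK //.
by case/andP: k_n => ? ?; rewrite lerN2 lerNl; apply/andP.
Qed.

Lemma sapp_inj n (s : 'B_n) (k l : int) :
  - n%:Z <= k <= n%:Z -> - n%:Z <= l <= n%:Z -> sapp s k = sapp s l -> k = l.
Proof.
move=> k_n l_n /(can_inj (@ord_intK n)) /perm_inj eq_kl.
by rewrite -(int_ordK k_n) eq_kl int_ordK.
Qed.

Lemma sapp_bound n (s : 'B_n) (k : int) : (`|sapp s k| <= n)%N.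
Proof.
rewrite /sapp /ord_int; set j := s _.
rewrite -lez_nat abszE ler_norml lerBrDr addNr lerBlDr -PoszD addnn /=.
by rewrite lez_nat -ltnS ltn_ord.
Qed.

Lemma sapp0 n (s : 'B_n) : sapp s 0 = 0.
Proof.
have /eqP : sapp s 0 = - sapp s 0 by rewrite -sappN ?oppr0 ?oppr_le0.
by rewrite -addr_eq0 -mulr2n mulrn_eq0 => /eqP.
Qed.

Definition Des n (s : 'B_n) : seq nat :=
  [seq i <- index_iota 1 n | sapp s i%:Z > sapp s i.+1%:Z].
Definition des n (s : 'B_n) : nat := size (Des s).
Definition maj n (s : 'B_n) : nat := (\sum_(i <- Des s) i)%N.
Definition Neg n (s : 'B_n) : seq nat :=
  [seq i <- index_iota 1 n.+1 | sapp s i%:Z < 0].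
Definition neg n (s : 'B_n) : nat := size (Neg s).
Definition fdes n (s : 'B_n) : nat := (2 * des s + (sapp s 1 < 0)%R)%N.
Definition fmaj n (s : 'B_n) : nat := (2 * maj s + neg s)%N.

(* A permutation of {1, ..., n} is an element of 'S_n, where i : 'I_n stands
   for the integer i.+1. *)
Lemma ord_in_range n (i : 'I_n) : - n%:Z <= i.+1%:Z <= n%:Z.
Proof. by rewrite (le_trans (_ : _ <= 0)) ?oppr_le0 //= lez_nat. Qed.

Lemma sapp_abs_gt0 n (s : 'B_n) (i : 'I_n) : (0 < `|sapp s i.+1%:Z|)%N.
Proof.
rewrite absz_gt0; apply/eqP=> s0.
suff : i.+1%:Z = 0 by [].
apply: (@sapp_inj n s); rewrite ?ord_in_range ?oppr_le0 //=.
by rewrite sapp0.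
Qed.

Lemma abs_fun_subproof n (s : 'B_n) (i : 'I_n) :
  (`|sapp s i.+1%:Z|.-1 < n)%N.
Proof. by rewrite prednK ?sapp_abs_gt0 ?sapp_bound. Qed.

Definition abs_fun n (s : 'B_n) (i : 'I_n) : 'I_n :=
  Ordinal (abs_fun_subproof s i).

Lemma abs_fun_inj n (s : 'B_n) : injective (abs_fun s).
Proof.
move=> i j /(congr1 (fun k : 'I_n => k.+1)).
rewrite /= !prednK ?sapp_abs_gt0 // => eq_abs.
have : `|sapp s i.+1%:Z| == `|sapp s j.+1%:Z| by rewrite -!abszE eq_abs.
rewrite eqr_norm2 => /orP[] /eqP.
  move/(sapp_inj (ord_in_range i) (ord_in_range j)) => [eq_ij].
  exact: val_inj.
rewrite -sappN ?ord_in_range // => /(sapp_inj (ord_in_range i)) eq_ij.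
suff : i.+1%:Z = - j.+1%:Z by [].
apply: eq_ij; case/andP: (ord_in_range j) => ? ?.
by rewrite lerN2 lerNl; apply/andP.
Qed.

Definition abs_perm n (s : 'B_n) : 'S_n := perm (@abs_fun_inj n s).

Lemma abs_permE n (s : 'B_n) (i : 'I_n) :
  (abs_perm s i).+1 = `|sapp s i.+1%:Z|%N.
Proof. by rewrite permE /= prednK ?sapp_abs_gt0. Qed.

(* The letter pi_i of the word of pi, with positions and letters in
   {1, ..., n}. *)
Definition letter n (p : 'S_n) (i : 'I_n) : nat := (p i).+1.

Definition Exc n (p : 'S_n) : {set 'I_n} := [set i : 'I_n | (i.+1 < letter p i)%N].
Definition exc n (p : 'S_n) : nat := #|Exc p|.

(* enum 'I_n lists the positions in increasing order. *)
Definition Eword n (p : 'S_n) : seq nat :=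
  [seq letter p i | i <- enum 'I_n & i \in Exc p].
Definition Nword n (p : 'S_n) : seq nat :=
  [seq letter p i | i <- enum 'I_n & i \notin Exc p].

Definition inv_word (u : seq nat) : nat :=
  #|[set ij : 'I_(size u) * 'I_(size u) |
      (ij.1 < ij.2)%N && (nth 0%N u ij.1 > nth 0%N u ij.2)%N]|.
Definition imv_word (u : seq nat) : nat :=
  #|[set ij : 'I_(size u) * 'I_(size u) |
      (ij.1 < ij.2)%N && (nth 0%N u ij.1 >= nth 0%N u ij.2)%N]|.

Definition denH n (p : 'S_n) : nat :=
  (\sum_(i in Exc p) i.+1 + imv_word (Eword p) + inv_word (Nword p))%N.

Definition exc_abs n (s : 'B_n) : nat := (exc (abs_perm s) + neg s)%N.

Definition nden n (s : 'B_n) : int :=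
  (denH (abs_perm s))%:Z - \sum_(i <- Neg s) sapp s i%:Z.

(* Hence nden can be used as a natural exponent through absz. *)
Lemma nden_ge0 n (s : 'B_n) : 0 <= nden s.
Proof.
rewrite /nden -sumrN addr_ge0 // /Neg big_filter sumr_ge0 // => i neg_i.
by rewrite oppr_ge0 ltW.
Qed.

(* Main.v *)
(* Both sides equal A_n(t) prod_(1 <= i <= n) (1 + t q^i), where
   A_n(t) = sum_(p in S_n) q^denH(p) t^exc(p).  On the left this is the choice
   of the signs, letter by letter.

   For A_n, read a permutation matrix through its top left i x i corners. Such
   a corner is a partial injection with h positions (and h values) still open.
   The contribution of each new row and column to denH depends on h only, and
   weighting a partial injection by [h]_q! x^h gives polynomials
   G_i(x, t) with A_i(t) = G_i(0, t) and, D being the q-derivative in x,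
     G_i = (1 + t q^i x) D ((1 + x) G_(i-1)).
   By induction g_i = (1 + x) G_i satisfies
     (1 + t q^(i+1) x) g_i(x, t) - (1 + x) g_i(qx, t)
       + q x (1 - t) g_i(x, qt) = 0,
   whose first-order term in x is the Carlitz recurrence
     (1 - q) A_(i+1)(t) = (1 - t q^(i+1)) A_i(t) - q (1 - t) A_i(qt).

   On the right, inserting n+1 and -(n+1) into the window of an element of B_n
   gives
     (1 - q) B_(n+1)(t) = (1 - t^2 q^(2n+2)) B_n(t)
                            - q (1 - t) (1 + tq) B_n(qt),
   the recurrence satisfied by A_n(t) prod_i (1 + t q^i).  To divide by 1 - q,
   one works with indeterminates q and t over the integers, and specializes. *)
Require Import Defs.
From mathcomp Require Import all_boot all_order all_algebra all_fingroup.
From mathcomp Require Import zify ring.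

Set Implicit Arguments.
Unset Strict Implicit.
Unset Printing Implicit Defensive.

Import Order.TTheory GRing.Theory Num.Theory.
Local Open Scope ring_scope.

(** * Partial permutation words *)

(* Words are stored in reverse order: the head is the letter at the last
   position, which is the size of the word.  The letter 0 marks an open
   position, one that will receive a letter exceeding the size of the word.
   [fill n w] lists the ways of putting the letter n at an open position. *)
Fixpoint fill (n : nat) (w : seq nat) : seq (seq nat) :=
  if w is x :: w' then
    (if x == 0%N then [:: n :: w'] else [::]) ++ [seq x :: v | v <- fill n w']
  else [::].

Definition unfill (n : nat) (w : seq nat) : seq nat :=
  [seq if x == n then 0%N else x | x <- w].

Definition missing (n : nat) (w : seq nat) : seq nat :=
  [seq v <- iota 1 n | v \notin w].

Fixpoint partial_words (n : nat) : seq (seq nat) :=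
  if n is m.+1 then
    [seq x :: v | v <- [seq v | w <- partial_words m, v <- w :: fill n w],
                  x <- 0%N :: missing n v]
  else [:: [::]].

Definition is_partial_word (n : nat) (w : seq nat) : bool :=
  [&& size w == n, all (leq^~ n) w & uniq [seq x <- w | x != 0%N]].

Definition open_exc (p x : nat) : bool := (x == 0%N) || (p < x)%N.

(* Contribution of the letter x, placed after w: at an (open or closed)
   excedance, the position and the inversions with earlier excedance letters;
   otherwise, the inversions with later letters, which are the smaller values
   not yet used. *)
Definition den_step (x : nat) (w : seq nat) : nat :=
  if open_exc (size w).+1 x then
    ((size w).+1 + (if x == 0 then 0 else count (open_exc x) w))%N
  else size (missing x.-1 w).

Fixpoint den_word (w : seq nat) : nat :=
  if w is x :: w' then (den_step x w' + den_word w')%N else 0%N.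

Fixpoint exc_word (w : seq nat) : nat :=
  if w is x :: w' then (open_exc (size w) x + exc_word w')%N else 0%N.

Lemma unfill_id n w : n \notin w -> unfill n w = w.
Proof.
move=> n_w; rewrite /unfill -[RHS]map_id; apply/eq_in_map => z z_w.
by case: eqP => // z_n; rewrite z_n (negPf n_w) in z_w.
Qed.

(** Erasing [n] undoes [fill], so a filled word determines the word it comes from. *)
Lemma mem_fill n w v : (0 < n)%N -> n \notin w ->
  (v \in fill n w) = (unfill n v == w) && (count_mem n v == 1%N).
Proof.
move=> n_gt0; elim: w v => [|x w IHw] v /=.
  by case: v => [|y v] //=; rewrite in_nil.
rewrite inE negb_or eq_sym => /andP[x_n n_w]; rewrite mem_cat.
case: v => [|y v] /=.
  by case: (x == 0%N); rewrite ?inE /=; apply/mapP => -[] //.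
rewrite eqseq_cons.
have -> : ((y :: v) \in [seq x :: u | u <- fill n w]) = (y == x) && (v \in fill n w).
  apply/mapP/andP => [[u u_w [-> ->]]|[/eqP-> v_w]]; first by rewrite eqxx.
  by exists v.
rewrite IHw //.
have -> : (y :: v \in (if x == 0%N then [:: n :: w] else [::])) =
   [&& x == 0%N, y == n & v == w].
  by case: (x == 0%N); rewrite ?inE ?eqseq_cons.
have vwE : (v == w) = (unfill n v == w) && (count_mem n v == 0%N).
  apply/eqP/andP => [->|[/eqP<- /eqP/count_memPn n_v]].
    by rewrite unfill_id // eqxx; split=> //; apply/eqP/count_memPn.
  by rewrite unfill_id.
rewrite vwE; case: (eqVneq y n) => [->|y_n] /=.
  by rewrite [n == x]eq_sym (negPf x_n) orbF add1n eqSS andbA [0%N == x]eq_sym.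
by rewrite andbF add0n andbA.
Qed.

Lemma uniq_fill n w : (0 < n)%N -> n \notin w -> uniq (fill n w).
Proof.
move=> n_gt0; elim: w => [|x w IHw] //=.
rewrite inE negb_or => /andP[x_n n_w]; rewrite cat_uniq.
apply/and3P; split; first by case: (x == _).
  apply/hasPn => _ /mapP[u _ ->].
  by case: (x == 0%N); rewrite ?inE //= eqseq_cons [x == n]eq_sym (negPf x_n).
by rewrite map_inj_uniq ?IHw // => u v [].
Qed.

Lemma mem_cons_fill n w v : (0 < n)%N -> n \notin w ->
  (v \in w :: fill n w) = (unfill n v == w) && (count_mem n v <= 1)%N.
Proof.
move=> n_gt0 n_w; rewrite inE mem_fill //.
case: (posnP (count_mem n v)) => [n_v|n_v].
  have n_v' : n \notin v by apply/count_memPn.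
  by rewrite n_v andbF orbF andbT unfill_id.
have -> : (v == w) = false.
  apply/eqP=> v_w; move: n_v; rewrite v_w; move/count_memPn: (n_w) => ->.
  by [].
by rewrite /=; congr (_ && _); case: (count_mem n v) n_v => [|[|]].
Qed.

Lemma partial_word_lt n w : is_partial_word n w -> n.+1 \notin w.
Proof.
case/and3P=> _ /allP le_w _; apply/negP => /le_w; by rewrite ltnn.
Qed.

Lemma uniq_nonzero_cons x (w : seq nat) :
  uniq [seq y <- x :: w | y != 0%N] =
    ((x == 0%N) || (x \notin w)) && uniq [seq y <- w | y != 0%N].
Proof. by rewrite /=; case: eqVneq => //= x0; rewrite mem_filter x0. Qed.

Lemma uniq_unfill n w : (0 < n)%N ->
  uniq [seq y <- w | y != 0%N] =
    uniq [seq y <- unfill n w | y != 0%N] && (count_mem n w <= 1)%N.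
Proof.
move=> n_gt0; elim: w => [|x w IHw] //.
rewrite [unfill _ _]/= !uniq_nonzero_cons IHw /=.
have [->|x_n] := eqVneq x n.
  have nw : (n \notin w) = (count_mem n w == 0%N) by apply/count_memPn/eqP.
  rewrite eqxx /= nw (gtn_eqF n_gt0) /=.
  by case: (count_mem n w) => [|k]; rewrite ?andbT ?andbF.
rewrite add0n andbA; case: (x =P 0%N) => //= x0.
congr (_ && _ && _); congr (~~ _).
apply/idP/mapP => [x_w|[y y_w]].
  by exists x => //; rewrite (negPf x_n).
by case: eqP => // _ ->.
Qed.

(** Reverses one step of [partial_words]: remove the last letter [x], then reopen the position of
    [n.+1] in [v], if there is one. *)
Lemma is_partial_word_cons n x v :
  is_partial_word n.+1 (x :: v) =
  [&& is_partial_word n (unfill n.+1 v), (count_mem n.+1 v <= 1)%N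
    & (x \in 0%N :: missing n.+1 v)].
Proof.
rewrite /is_partial_word uniq_nonzero_cons (@uniq_unfill n.+1) // /= size_map eqSS.
rewrite all_map.
have -> : (x \in 0%N :: missing n.+1 v) = (x <= n.+1)%N && ((x == 0%N) || (x \notin v)).
  rewrite inE mem_filter mem_iota add1n ltnS.
  by case: x => [|x] //=; rewrite andbC.
have -> : all (leq^~ n.+1) v =
    all (preim (fun x0 => if x0 == n.+1 then 0%N else x0) (leq^~ n)) v.
  apply: eq_all => y /=; case: eqP => [->|]; first by rewrite leqnn.
  by move=> y_n; apply/idP/idP; lia.
set b := all _ v; set c := uniq [seq y <- unfill _ _ | _].
by case: (size v == n); case: b; case: c; case: (count_mem _ _ <= 1)%N;
  rewrite /= ?andbT ?andbF.
Qed.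

Lemma mem_partial_words n w : (w \in partial_words n) = is_partial_word n w.
Proof.
elim: n w => [|n IHn] w.
  by rewrite inE /is_partial_word; case: w.
case: w => [|x v].
  apply/negbTE/negP; move/allpairsPdep => [a [b []]] //.
rewrite is_partial_word_cons -IHn.
apply/allpairsPdep/and3P => [[v' [x' [v'_n x'_n [-> ->]]]]|[w_n c_v x_v]].
  have/allpairsPdep[w [v2 [w_n v2_w v2E]]] := v'_n; rewrite -{v2}v2E in v2_w.
  move: v2_w; rewrite mem_cons_fill //; last by apply: partial_word_lt; rewrite -IHn.
  by case/andP=> /eqP v2w c_v2; split=> //; rewrite v2w.
exists v, x; split=> //.
apply/allpairsPdep; exists (unfill n.+1 v), v; split=> //.
by rewrite mem_cons_fill ?eqxx // partial_word_lt // -IHn.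
Qed.

Lemma uniq_partial_words n : uniq (partial_words n).
Proof.
elim: n => [|n IHn] //.
have Nn w : w \in partial_words n -> n.+1 \notin w.
  by rewrite mem_partial_words => /partial_word_lt.
rewrite /partial_words -/partial_words.
apply: (@allpairs_uniq_dep _ (fun=> nat) _ (fun v x => x :: v)).
- apply: (@allpairs_uniq_dep _ (fun=> seq nat) _ (fun w v => v)) => //.
    move=> w /Nn n_w; rewrite cons_uniq uniq_fill // andbT mem_fill //.
    by move/count_memPn: n_w => ->; rewrite andbF.
  move=> _ _ /allpairsPdep[w [v [/Nn n_w v_w ->]]] /allpairsPdep[w' [v' [/Nn n_w' v_w' ->]]] /=.
  move=> vv'; rewrite -vv' in v_w' *.
  move: v_w v_w'; rewrite !mem_cons_fill // => /andP[/eqP<- _] /andP[/eqP<- _].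
  by [].
- move=> v _; rewrite cons_uniq filter_uniq ?iota_uniq // andbT.
  by rewrite mem_filter mem_iota andbF.
by move=> [a b] [c d] _ _ /= [-> ->].
Qed.

Lemma missing_rcons n w :
  missing n.+1 w = missing n w ++ (if n.+1 \in w then [::] else [:: n.+1]).
Proof.
rewrite /missing -{1}[n.+1]addn1 iotaD filter_cat /= add1n.
by case: (_ \in w).
Qed.

(** The distinct nonzero letters are counted twice: as positions that are not open, and as values
    that are not missing. *)
Lemma size_missing n w :
  all (leq^~ n) w -> uniq [seq x <- w | x != 0%N] ->
  (size (missing n w) + size w = n + count_mem 0%N w)%N.
Proof.
move=> /allP le_w u_w.
have -> : size w = (count_mem 0%N w + size [seq x <- w | x != 0%N])%N.
  by rewrite size_filter -(count_predC (pred1 0%N)).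
suff -> : size [seq x <- w | x != 0%N] = count (mem w) (iota 1 n).
  rewrite addnCA addnC; congr (_ + _)%N.
  by rewrite /missing size_filter -[n in RHS](size_iota 1) -(count_predC (mem w)) addnC.
rewrite -size_filter; apply/perm_size/uniq_perm => //.
  by rewrite filter_uniq ?iota_uniq.
move=> x; rewrite !mem_filter mem_iota andbC /= add1n ltnS -lt0n.
by case: (boolP (x \in w)) => // /le_w ->; rewrite andbT.
Qed.

(** [fill] replaces a single 0 by [n], which a predicate not separating the two cannot see. *)
Lemma fill_count n w v (a : pred nat) : v \in fill n w -> a n = a 0%N ->
  count a v = count a w.
Proof.
move=> + an; elim: w v => [|x w IHw] v //=; rewrite mem_cat => /orP[|].
  by case: eqP => // ->; rewrite inE => /eqP-> /=; rewrite an.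
by case/mapP => u /IHw e ->; rewrite /= e.
Qed.

Lemma fill_size n w v : v \in fill n w -> size v = size w.
Proof. by move=> v_w; rewrite -!count_predT (fill_count v_w). Qed.

Lemma fill_count0 n w v : (0 < n)%N -> v \in fill n w ->
  count_mem 0%N w = (count_mem 0%N v).+1.
Proof.
move=> n_gt0; elim: w v => [|x w IHw] v //=; rewrite mem_cat => /orP[|].
  by case: (x =P 0%N) => // _; rewrite inE => /eqP-> /=; rewrite (gtn_eqF n_gt0).
by case/mapP => u /IHw e ->; rewrite /= e addnS.
Qed.

(** An open position already counts as an excedance, and the letter that closes it exceeds the size
    of the word. *)
Lemma fill_exc n w v : (size w < n)%N -> v \in fill n w -> exc_word v = exc_word w.
Proof.
elim: w v => [|x w IHw] v //= wn; rewrite mem_cat => /orP[|].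
  by case: eqP => // ->; rewrite inE => /eqP-> /=; rewrite /open_exc wn orbT.
by case/mapP => u u_w ->; rewrite /= (IHw _ (ltnW wn) u_w) (fill_size u_w).
Qed.

(** For a letter [x] below [n], the letter [n] acts like the 0 it replaces: both are larger
    excedance letters, and neither uses a value below [x]. *)
Lemma fill_den_step n w v x : (x < n)%N -> v \in fill n w ->
  den_step x v = den_step x w.
Proof.
move=> xn v_w; rewrite /den_step (fill_size v_w).
case: ifP => _.
  case: eqP => // _; congr (_ + _)%N; apply: fill_count v_w _.
  by rewrite /open_exc eqxx xn orbT.
congr size; apply: eq_in_filter => y; rewrite mem_iota => /andP[y_gt0 y_x].
congr (~~ _); rewrite -!has_pred1 !has_count.
have yn : (y < n)%N by lia.
by rewrite (fill_count v_w) //= (gtn_eqF yn) (ltn_eqF y_gt0).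
Qed.

(** * Generating functions of partial words *)

Section Sums.
Variable R : comNzRingType.
Implicit Types q t x : R.

Definition qint q k := \sum_(i < k) q ^+ i.
Definition qfact q k := \prod_(i < k) qint q i.+1.

Lemma qintE q k : (1 - q) * qint q k = 1 - q ^+ k.
Proof. by rewrite -opprB mulNr -subrX1 opprB. Qed.

Lemma qfactS q k : qfact q k.+1 = qfact q k * qint q k.+1.
Proof. by rewrite /qfact big_ord_recr. Qed.

Lemma sum_missing q n w :
  \sum_(v <- missing n w) q ^+ size (missing v.-1 w) =
  qint q (size (missing n w)).
Proof.
elim: n => [|n IHn]; first by rewrite big_nil /qint big_ord0.
rewrite missing_rcons big_cat IHn /=.
case: ifP => _; first by rewrite big_nil cats0 addr0.
by rewrite big_seq1 size_cat addn1 /qint big_ord_recr.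
Qed.

(** Closing a position with [n] adds the number of open positions before it, since these are to
    receive larger letters. Over the h open positions this number runs through 0, ..., h-1. *)
Lemma sum_fill q n w : (size w < n)%N -> all (ltn^~ n) w ->
  \sum_(v <- fill n w) q ^+ den_word v = q ^+ den_word w * qint q (count_mem 0%N w).
Proof.
elim: w => [|x w IHw] /=; first by rewrite big_nil /qint big_ord0 mulr0.
move=> wn /andP[xn ltw]; rewrite big_cat big_map /=.
have -> : \sum_(v <- fill n w) q ^+ (den_step x v + den_word v) =
    q ^+ den_step x w * \sum_(v <- fill n w) q ^+ den_word v.
  rewrite mulr_sumr; apply: eq_big_seq => v v_w.
  by rewrite (fill_den_step xn v_w) exprD.
rewrite IHw ?(ltnW wn) // mulrA -exprD.
case: eqP => [->|_]; last by rewrite big_nil add0r.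
rewrite big_seq1 /= add1n {2}/qint big_ord_recr /= -/(qint _ _) mulrDr addrC.
congr (_ + _); rewrite -exprD; congr (_ ^+ _).
rewrite /den_step /open_exc eqxx wn orbT /= gtn_eqF ?(leq_ltn_trans _ wn) //.
rewrite addn0 -addnA addnAC addnA; congr (_ + _ + _)%N; last first.
apply: eq_in_count => y /(allP ltw) yn /=.
by rewrite [(n < y)%N]ltnNge ltnW ?orbF.
Qed.

(* The polynomial G_n(x, t). *)
Definition hist_gf q n x t :=
  \sum_(w <- partial_words n) q ^+ den_word w * t ^+ exc_word w *
     (qfact q (count_mem 0%N w) * x ^+ count_mem 0%N w).

Lemma hist_gf0 q x t : hist_gf q 0 x t = 1.
Proof. by rewrite /hist_gf /= big_seq1 /= !expr0 !mul1r /qfact big_ord0 mulr1. Qed.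

Lemma sum_last q n x t v :
  size v = n -> all (leq^~ n.+1) v -> uniq [seq y <- v | y != 0%N] ->
  \sum_(y <- 0%N :: missing n.+1 v) q ^+ den_word (y :: v) * t ^+ exc_word (y :: v) *
     (qfact q (count_mem 0%N (y :: v)) * x ^+ count_mem 0%N (y :: v)) =
  (1 + t * q ^+ n.+1 * x) *
  (q ^+ den_word v * t ^+ exc_word v *
   (qfact q (count_mem 0%N v).+1 * x ^+ count_mem 0%N v)).
Proof.
move=> sv le_v u_v; have := size_missing le_v u_v; rewrite sv.
set z := count_mem 0%N v => mz.
have {}mz : size (missing n.+1 v) = z.+1 by lia.
rewrite big_cons /= /den_step /open_exc eqxx sv /= addn0 -/z add1n.
under eq_big_seq => y.
  rewrite mem_filter mem_iota => /and3P[_ y_gt0 y_n].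
  rewrite gtn_eqF // ltnNge -ltnS y_n /= !add0n -/z exprD -!mulrA; over.
rewrite -mulr_suml sum_missing mz qfactS !exprD expr1 !exprS.
ring.
Qed.

(** This is the q-derivative of (1 + x) x^h, multiplied by (1 - q) x: [w] itself gives [h+1]_q x^h
    and its fillings give [h]_q x^(h-1). *)
Lemma sum_filled q n x t w : is_partial_word n w ->
  (1 - q) * x *
  (\sum_(v <- w :: fill n.+1 w) q ^+ den_word v * t ^+ exc_word v *
     (qfact q (count_mem 0%N v).+1 * x ^+ count_mem 0%N v)) =
  q ^+ den_word w * t ^+ exc_word w *
     (qfact q (count_mem 0%N w) *
       ((1 + x) * x ^+ count_mem 0%N w - (1 + q * x) * (q * x) ^+ count_mem 0%N w)).
Proof.
case/and3P => /eqP sw /allP le_w u_w; rewrite big_cons.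
under eq_big_seq => v v_w.
  have cv := fill_count0 (ltn0Sn n) v_w.
  rewrite (fill_exc _ v_w) ?sw // -cv -[count_mem 0%N v]/(_.+1.-1) -cv.
  rewrite -mulrA; over.
rewrite -mulr_suml sum_fill ?sw //; last by apply/allP => y /le_w.
set z := count_mem 0%N w; set d := _ ^+ den_word w; set e := _ ^+ exc_word w.
rewrite qfactS exprMn.
have -> : (1 - q) * x * (d * e * (qfact q z * qint q z.+1 * x ^+ z)
    + d * qint q z * (e * (qfact q z * x ^+ z.-1))) =
  d * e * qfact q z * (((1 - q) * qint q z.+1) * x ^+ z.+1
     + (1 - q) * qint q z * (x * x ^+ z.-1)).
  by rewrite exprS; ring.
rewrite !qintE.
(* Without open positions [z.-1] is truncated to 0, but the coefficient [1 - q ^+ z] of that term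
   vanishes. *)
case: z => [|z]; first by rewrite !expr0 expr1; ring.
by rewrite /= -exprS !exprS; ring.
Qed.

(** The q-derivative recurrence for G_n, cleared of its denominator (1 - q) x so that it makes sense
    in any commutative ring. *)
Lemma hist_gfS q n x t :
  (1 - q) * x * hist_gf q n.+1 x t =
  (1 + t * q ^+ n.+1 * x) *
    ((1 + x) * hist_gf q n x t - (1 + q * x) * hist_gf q n (q * x) t).
Proof.
rewrite /hist_gf [partial_words n.+1]/partial_words -/partial_words !big_allpairs_dep.
rewrite [(1 + x) * _]mulr_sumr [(1 + q * x) * _]mulr_sumr -sumrB !mulr_sumr.
apply: eq_big_seq => w; rewrite mem_partial_words => w_n.
have [/eqP sw _ _] := and3P w_n.
under eq_big_seq => v v_w.
  have : is_partial_word n.+1 (0%N :: v).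
    rewrite is_partial_word_cons mem_head andbT.
    move: v_w; rewrite mem_cons_fill ?partial_word_lt // => /andP[/eqP-> ->].
    by rewrite w_n.
  case/and3P => /= sv le_v u_v.
  rewrite sum_last //; last by apply/eqP.
  over.
rewrite -mulr_sumr mulrCA sum_filled //.
by ring.
Qed.
End Sums.

(** * The Carlitz recurrence *)

Lemma rmorph_hist_gf (R S : comNzRingType) (f : {rmorphism R -> S}) q n x t :
  f (hist_gf q n x t) = hist_gf (f q) n (f x) (f t).
Proof.
rewrite /hist_gf rmorph_sum; apply: eq_bigr => w _; rewrite !rmorphM !rmorphXn.
congr (_ * (_ * _)); rewrite rmorph_prod; apply: eq_bigr => i _.
by rewrite rmorph_sum; apply: eq_bigr => j _; rewrite rmorphXn.
Qed.

Lemma hist_gf_shift (R : idomainType) (q : R) n x t : q != 0 -> q != 1 ->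
  (1 + t * q ^+ n.+1 * x) * ((1 + x) * hist_gf q n x t) -
  (1 + x) * ((1 + q * x) * hist_gf q n (q * x) t) +
  q * x * (1 - t) * ((1 + x) * hist_gf q n x (q * t)) = 0.
Proof.
move=> q0 q1; elim: n x t => [|n IHn] x t.
  by rewrite !hist_gf0 expr1; ring.
(* 1 - q and x are cancelled below; at x = 0 the first two terms coincide. *)
have [->|x0] := eqVneq x 0; first by rewrite !mulr0; ring.
(* The extra factor [q] is there for the middle term: [hist_gfS] at [q * x] carries
   [(1 - q) * (q * x)]. *)
have c0 : q * ((1 - q) * x) != 0.
  by rewrite !mulf_neq0 // subr_eq0 eq_sym.
apply: (mulfI c0); rewrite mulr0.
have e1 := hist_gfS q n x t; have e2 := hist_gfS q n (q * x) t.
have e3 := hist_gfS q n x (q * t).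
have h1 := IHn x t; have h2 := IHn (q * x) t.
rewrite [q * x * (1 - t)]mulrC in h1 *.
transitivity ((1 + t * q ^+ n.+2 * x) * (1 + x) *
  (q * ((1 - q) * x * hist_gf q n.+1 x t))
  - (1 + x) * (1 + q * x) * ((1 - q) * (q * x) * hist_gf q n.+1 (q * x) t)
  + q * (1 - t) * x * q * (1 + x) * ((1 - q) * x * hist_gf q n.+1 x (q * t))).
  by ring.
rewrite e1 e2 e3.
(* q times the identity at x, minus the identity at qx *)
transitivity ((1 + x) * (1 + t * q ^+ n.+2 * x) *
 (q * ((1 + t * q ^+ n.+1 * x) * ((1 + x) * hist_gf q n x t) -
     (1 + x) * ((1 + q * x) * hist_gf q n (q * x) t) +
     (1 - t) * (q * x) * ((1 + x) * hist_gf q n x (q * t)))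
  - ((1 + t * q ^+ n.+1 * (q * x)) * ((1 + q * x) * hist_gf q n (q * x) t) -
     (1 + q * x) *
     ((1 + q * (q * x)) * hist_gf q n (q * (q * x)) t) +
     q * (q * x) * (1 - t) *
     ((1 + q * x) * hist_gf q n (q * x) (q * t))))).
  by rewrite !exprS; ring.
by rewrite h1 h2 mulr0 subr0 mulr0.
Qed.

(** Eliminating g_n(x, t) between [hist_gfS] and [hist_gf_shift] leaves a multiple of x, which
    cancels. *)
Lemma hist_gf_rec (R : idomainType) (q : R) n x t : q != 0 -> q != 1 -> x != 0 ->
  (1 - q) * hist_gf q n.+1 x t =
  (1 - t * q ^+ n.+1) * ((1 + q * x) * hist_gf q n (q * x) t) -
  q * (1 - t) * ((1 + x) * hist_gf q n x (q * t)).
Proof.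
move=> q0 q1 x0; apply: (mulfI x0).
rewrite mulrA [x * (1 - q)]mulrC hist_gfS.
apply/eqP; rewrite -subr_eq0; apply/eqP.
by rewrite -[RHS](hist_gf_shift n x t q0 q1); ring.
Qed.

(** Since [hist_gf_rec] excludes x = 0, it is applied to the indeterminate of [{poly R}], and the
    result is evaluated at 0. *)
Lemma den_gf_rec (R : idomainType) (q : R) n t : q != 0 -> q != 1 ->
  (1 - q) * hist_gf q n.+1 0 t =
  (1 - t * q ^+ n.+1) * hist_gf q n 0 t - q * (1 - t) * hist_gf q n 0 (q * t).
Proof.
move=> q0 q1.
have q0' : q%:P != 0 by rewrite polyC_eq0.
have q1' : q%:P != 1 by rewrite -polyC1 (inj_eq (@polyC_inj R)).
have X0 : 'X != 0 :> {poly R} by rewrite polyX_eq0.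
have := congr1 (horner_eval 0) (hist_gf_rec n t%:P q0' q1' X0).
rewrite !(rmorphB, rmorphM, rmorphD, rmorphXn, rmorph1, rmorph_hist_gf) /=.
by rewrite /horner_eval !hornerC hornerX !(mulr0, addr0, mul1r).
Qed.

(** * Signed words and flag statistics *)

Fixpoint insert_signed (m : nat) (w : seq int) : seq (seq int) :=
  [:: m%:Z :: w, - m%:Z :: w &
     if w is b :: w' then [seq b :: v | v <- insert_signed m w'] else [::]].

Fixpoint signed_words (n : nat) : seq (seq int) :=
  if n is m.+1 then [seq v | w <- signed_words m, v <- insert_signed m.+1 w]
  else [:: [::]].

Definition is_signed_word (n : nat) (w : seq int) : bool :=
  perm_eq [seq `|x|%N | x <- w] (iota 1 n).

Lemma eq_filterC (T : eqType) (a : pred T) (v w : seq T) : all (predC a) w ->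
  (v == w) = ([seq x <- v | ~~ a x] == w) && (count a v == 0%N).
Proof.
move=> wa; apply/eqP/andP => [->|[/eqP<- c0]].
  by rewrite (all_filterP wa) eqxx -leqn0 leqNgt -has_count -all_predC.
by apply/esym/all_filterP; rewrite all_predC has_count lt0n c0.
Qed.

(** As for [fill], deleting the letter of absolute value [m] recovers the original word. *)
Lemma mem_insert_signed m w v : all (fun x => `|x|%N != m) w ->
  (v \in insert_signed m w) =
    ([seq x <- v | `|x|%N != m] == w) && (count (fun x => `|x|%N == m) v == 1%N).
Proof.
elim: w v => [|b w IHw] v.
  move=> _; case: v => [|y v] //=; rewrite !inE !eqseq_cons.
  case: (eqVneq `|y|%N m) => /= ym.
    have -> : (y == m%:Z) && (v == [::]) || (y == - m%:Z) && (v == [::])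
        = (v == [::]) by case: (v == [::]); rewrite ?andbF //; lia.
    by rewrite add1n eqSS (@eq_filterC _ (fun x => `|x|%N == m)).
  have -> : (y == m%:Z) = false by lia.
  by have -> : (y == - m%:Z) = false by lia.
move=> /= /andP[bm wm]; case: v => [|y v] /=.
  by rewrite !inE /=; apply/mapP => -[].
rewrite !inE !eqseq_cons.
have -> : (y :: v \in [seq b :: u | u <- insert_signed m w]) =
    (y == b) && (v \in insert_signed m w).
  apply/mapP/andP => [[u u_w [-> ->]]|[/eqP-> v_w]]; first by rewrite eqxx.
  by exists v.
rewrite IHw //.
rewrite (@eq_filterC _ (fun x => `|x|%N == m)) /= ?bm //; case: (eqVneq `|y|%N m) => /= ym.
  have -> : (y == b) = false by apply/eqP => yb; move: bm; rewrite -yb ym eqxx.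
  have e : (y == m%:Z) || (y == - m%:Z) by lia.
  by rewrite /= orbF add1n eqSS -andb_orl e.
have -> : (y == m%:Z) = false by lia.
have -> : (y == - m%:Z) = false by lia.
by rewrite eqseq_cons add0n -andbA.
Qed.

Lemma uniq_insert_signed m w : (0 < m)%N -> all (fun x => `|x|%N != m) w ->
  uniq (insert_signed m w).
Proof.
move=> m0; elim: w => [|b w IHw] /=.
  by rewrite !inE eqseq_cons andbT; lia.
case/andP=> bm wm; rewrite map_inj_uniq ?IHw // => [|u v []] //.
rewrite andbT inE eqseq_cons negb_or.
have -> : (m%:Z == - m%:Z) = false by lia.
apply/andP; split=> /=.
  by apply/mapP => -[u _ [mb]]; move: bm; rewrite -mb /= eqxx.
by apply/mapP => -[u _ [mb]]; move: bm; rewrite -mb abszN /= eqxx.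
Qed.

Lemma is_signed_wordS n w : is_signed_word n.+1 w =
  is_signed_word n [seq x <- w | `|x|%N != n.+1] &&
    (count (fun x => `|x|%N == n.+1) w == 1%N).
Proof.
rewrite /is_signed_word -(filter_map _ (fun x => x != n.+1)).
have -> : count (fun x => `|x|%N == n.+1) w = count_mem n.+1 [seq `|x|%N | x <- w].
  by rewrite count_map.
move: [seq _ | x <- w] => u.
have iE : perm_eq (iota 1 n.+1) (n.+1 :: iota 1 n).
  by rewrite -{1}[n.+1]addn1 iotaD add1n cats1 perm_rcons.
rewrite (permPr iE).
have niota : n.+1 \notin iota 1 n by rewrite mem_iota add1n ltnn andbF.
have fi : [seq x <- iota 1 n | x != n.+1] = iota 1 n.
  apply/all_filterP/allP => x x_n; apply/eqP => xn.
  by rewrite -xn x_n in niota.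
apply/idP/andP => [un|[un c1]].
  split; last by rewrite (seq.permP un) /= eqxx (count_memPn niota).
  have := perm_filter (fun x => x != n.+1) un.
  by rewrite /= eqxx fi.
rewrite perm_sym in un; rewrite perm_sym.
apply: (@perm_trans _ (n.+1 :: [seq x <- u | x != n.+1])); first by rewrite perm_cons.
rewrite perm_sym.
apply: (@perm_trans _ ([seq x <- u | x == n.+1] ++ [seq x <- u | x != n.+1])).
  by rewrite perm_sym perm_filterC.
suff -> : [seq x <- u | x == n.+1] = [:: n.+1] by [].
have : all (pred1 n.+1) [seq x <- u | x == n.+1] by exact: filter_all.
by move/all_pred1P ->; rewrite size_filter (eqP c1).
Qed.

Lemma signed_word_lt n w : is_signed_word n w -> all (fun x => `|x|%N != n.+1) w.
Proof.
move=> /perm_mem w_n; apply/allP => x xw; apply/eqP => xn.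
have := w_n n.+1; rewrite mem_iota add1n ltnn andbF -xn.
by rewrite map_f.
Qed.

Lemma mem_signed_words n w : (w \in signed_words n) = is_signed_word n w.
Proof.
elim: n w => [|n IHn] w.
  rewrite inE /is_signed_word; case: w => [|x w] //.
  by apply/esym/negbTE/negP => /perm_size.
rewrite is_signed_wordS [signed_words n.+1]/signed_words -/signed_words.
apply/allpairsPdep/andP => [[u [v [u_n v_u ->]]]|[w_n c1]].
  move: v_u; rewrite mem_insert_signed ?signed_word_lt -?IHn //.
  by case/andP => /eqP-> ->.
exists [seq x <- w | `|x|%N != n.+1], w; rewrite IHn; split=> //.
by rewrite mem_insert_signed ?eqxx // signed_word_lt.
Qed.

Lemma uniq_signed_words n : uniq (signed_words n).
Proof.
elim: n => [|n IHn] //.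
rewrite /signed_words -/signed_words.
apply: (@allpairs_uniq_dep _ (fun=> seq int) _ (fun w v => v)) => //.
  by move=> w w_n; rewrite uniq_insert_signed // signed_word_lt // -mem_signed_words.
move=> _ _ /allpairsPdep[w [v [w_n v_w ->]]] /allpairsPdep[w' [v' [w_n' v_w' ->]]] /=.
move=> vv'; rewrite -vv' in v_w' *; move: v_w v_w'.
rewrite !mem_insert_signed ?signed_word_lt -?mem_signed_words //.
by move=> /andP[/eqP<- _] /andP[/eqP<- _].
Qed.

Section Weights.
Variable R : comNzRingType.
Implicit Types q t : R.

Definition des_weight q t (p : nat) : R :=
  if p is 0%N then t else t ^+ 2 * q ^+ (2 * p).

(* The letter a is at position p, just before w.  Starting with a = 0 at
   position 0 makes the sign of the first letter a descent of weight t. *)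
Fixpoint flag_weight q t (a : int) (p : nat) (w : seq int) : R :=
  if w is b :: w' then
    (if b < a then des_weight q t p else 1) * (if b < 0 then q else 1) *
      flag_weight q t b p.+1 w'
  else 1.

Lemma flag_weight_cons q t a p b w : flag_weight q t a p (b :: w) =
  (if b < a then des_weight q t p else 1) * (if b < 0 then q else 1) *
      flag_weight q t b p.+1 w.
Proof. by []. Qed.

(** Moving a positive position by one multiplies its descent weight by [q ^+ 2], which [t ^+ 2]
    absorbs. At position 0 the weight is linear in [t], hence the start at [p.+1]. *)
Lemma flag_weight_shift q t a p w :
  flag_weight q t a p.+2 w = flag_weight q (q * t) a p.+1 w.
Proof.
elim: w a p => [|b w IHw] a p //=; rewrite IHw; congr (_ * _ * _).
by case: ifP => // _; rewrite !mulnS !exprS; ring.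
Qed.

(** Induction on [w], separating the two insertions in front from those after the first letter. The
    bounds make [m] larger and [- m] smaller than every neighbour, which fixes the new descents; the
    letters moved up by one position account for [q * t]. *)
Lemma sum_insert_signed q t m a p w :
  all (fun x => (- m%:Z < x < m%:Z)%R) (a :: w) ->
  (1 - q) * \sum_(v <- insert_signed m w) flag_weight q t a p.+1 v =
  (1 - t ^+ 2 * q ^+ (2 * (p.+1 + size w).+1)) * flag_weight q t a p.+1 w -
  q * (1 - t ^+ 2 * q ^+ (2 * p.+1)) * flag_weight q (q * t) a p.+1 w.
Proof.
elim: w a p => [|b w IHw] a p; rewrite [all _ _]/=.
  case/andP=> /andP[a1 a2] _; rewrite big_cons big_seq1 !flag_weight_cons a1 [_ < a]lt_gtF //.
  have -> : (m%:Z < 0 :> int) = false by lia.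
  have -> : - m%:Z < 0 :> int by lia.
  by rewrite /= addn0 !mulnS !exprS; ring.
case/and3P=> /andP[a1 a2] /andP[b1 b2] wm.
rewrite !big_cons big_map; under eq_bigr do rewrite flag_weight_cons.
rewrite !flag_weight_cons a1 b2 [_ < a]lt_gtF // [b < - _]lt_gtF //.
have -> : (m%:Z < 0 :> int) = false by lia.
have -> : - m%:Z < 0 :> int by lia.
rewrite -mulr_sumr /= !mulrDr [X in _ + (_ + X)]mulrCA IHw /= ?b1 ?b2 //.
rewrite flag_weight_shift addSnnS.
set u := flag_weight q t b _ w; set v := flag_weight q _ b _ w.
set s := if b < 0 then _ else _; set A := 1 - _ * q ^+ (2 * (_ + _).+1).
by case: (b < a); rewrite !mulnS !exprS; ring.
Qed.

(** The insertions after the first letter fall under [sum_insert_signed]. Those in front involve the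
    weight [t] of position 0, whence [(1 - t) * (1 + t * q)]. *)
Lemma sum_insert_signed0 q t m w :
  all (fun x => (- m%:Z < x < m%:Z)%R) (0 :: w) ->
  (1 - q) * \sum_(v <- insert_signed m w) flag_weight q t 0 0 v =
  (1 - t ^+ 2 * q ^+ (2 * (size w).+1)) * flag_weight q t 0 0 w -
  q * (1 - t) * (1 + t * q) * flag_weight q (q * t) 0 0 w.
Proof.
rewrite [all _ _]/= => /andP[/andP[m1 m2]].
case: w => [_|b w].
  rewrite big_cons big_seq1 !flag_weight_cons m1 lt_gtF //.
  by rewrite /= muln1; ring.
case/andP=> /andP[b1 b2] wm.
rewrite !big_cons big_map; under eq_bigr do rewrite flag_weight_cons.
rewrite !flag_weight_cons m1 b2 [_ < 0]lt_gtF // [b < - _]lt_gtF //.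
rewrite -mulr_sumr /= !mulrDr [X in _ + (_ + X)]mulrCA sum_insert_signed /= ?b1 ?b2 //.
rewrite flag_weight_shift add1n.
set u := flag_weight q t b _ w; set v := flag_weight q _ b _ w.
set A := 1 - _ * q ^+ (2 * _.+2).
by case: (b < 0); rewrite !mulnS !exprS; ring.
Qed.

Definition flag_gf q n t := \sum_(w <- signed_words n) flag_weight q t 0 0 w.

Lemma flag_gf_rec q n t :
  (1 - q) * flag_gf q n.+1 t =
  (1 - t ^+ 2 * q ^+ (2 * n.+1)) * flag_gf q n t -
  q * (1 - t) * (1 + t * q) * flag_gf q n (q * t).
Proof.
rewrite /flag_gf [signed_words n.+1]/signed_words -/signed_words big_allpairs_dep.
rewrite !mulr_sumr -sumrB; apply: eq_big_seq => w; rewrite mem_signed_words => w_n.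
have sw : size w = n by move: (perm_size w_n); rewrite size_map size_iota.
rewrite sum_insert_signed0 ?sw //; apply/allP => x; rewrite inE.
case/orP => [/eqP->|xw]; first by lia.
have := perm_mem w_n `|x|%N; rewrite map_f // mem_iota => /esym.
by lia.
Qed.

End Weights.

(** * Denert's statistic of a word *)

Section Inversions.
Variable r : rel nat.
Local Open Scope nat_scope.

Definition inversions (u : seq nat) : nat :=
  \sum_(i < size u) \sum_(j < size u) ((i < j) && r (nth 0 u i) (nth 0 u j)).

Lemma card_inversions u :
  #|[set ij : 'I_(size u) * 'I_(size u) |
      (ij.1 < ij.2) && r (nth 0 u ij.1) (nth 0 u ij.2)]| = inversions u.
Proof.
rewrite /inversions pair_bigA -sum1_card big_mkcond /=.
by apply: eq_bigr => -[i j] _; rewrite inE /=; case: (_ && _).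
Qed.

Lemma sum_nth_count (a : pred nat) u : \sum_(i < size u) a (nth 0 u i) = count a u.
Proof.
rewrite -sum1_count [RHS]big_mkcond [RHS](big_nth 0) big_mkord.
by apply: eq_bigr => i _; case: (a _).
Qed.

Lemma inversions_cons x u : inversions (x :: u) = inversions u + count (r x) u.
Proof.
rewrite /inversions /= big_ord_recl big_ord_recl /= add0n addnC; congr (_ + _).
  by apply: eq_bigr => i _; rewrite big_ord_recl.
by rewrite -sum_nth_count; apply: eq_bigr.
Qed.

Lemma inversions_rcons u x :
  inversions (rcons u x) = inversions u + count (r^~ x) u.
Proof.
elim: u => [|y u IHu]; first by rewrite inversions_cons.
rewrite rcons_cons !inversions_cons IHu -cats1 count_cat /=.
by rewrite addn0; lia.
Qed.

End Inversions.

Lemma inv_wordE u : inv_word u = inversions (fun x y => y < x)%N u.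
Proof. by rewrite -card_inversions. Qed.

Lemma imv_wordE u : imv_word u = inversions (fun x y => y <= x)%N u.
Proof. by rewrite -card_inversions. Qed.

Section FunctionWord.
Local Open Scope nat_scope.
Variables (f : nat -> nat) (n : nat).
Hypothesis f_perm : perm_eq [seq f k | k <- iota 1 n] (iota 1 n).

Let f_gt0 k : 0 < k <= n -> 0 < f k.
Proof.
move=> k_n; have := perm_mem f_perm (f k).
by rewrite map_f ?mem_iota ?add1n // => /esym/andP[].
Qed.

Let f_inj : {in [pred k | 0 < k <= n] &, injective f}.
Proof.
have u_f : uniq [seq f k | k <- iota 1 n] by rewrite (perm_uniq f_perm) iota_uniq.
move=> k l; rewrite !inE => k_n l_n fkl.
have nth_f j : 0 < j <= n -> nth 0 [seq f i | i <- iota 1 n] j.-1 = f j.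
  by case: j => // j /andP[_ jn]; rewrite (nth_map 0) ?size_iota // nth_iota.
have := nth_uniq 0 (i := k.-1) (j := l.-1) _ _ u_f.
rewrite size_map size_iota !nth_f // fkl eqxx => /(_ _ _)/esym/eqP.
by lia.
Qed.

Lemma iotaS_rcons m : iota 1 m.+1 = rcons (iota 1 m) m.+1.
Proof. by rewrite -{1}[m.+1]addn1 iotaD add1n cats1. Qed.

Lemma exc_word_fun m : m <= n ->
  exc_word (rev [seq f k | k <- iota 1 m]) = count (fun k => k < f k) (iota 1 m).
Proof.
elim: m => [|m IHm] // mn.
rewrite iotaS_rcons map_rcons rev_rcons /= size_rev size_map size_iota IHm 1?ltnW //.
by rewrite -cats1 count_cat /= addn0 addnC /open_exc gtn_eqF ?f_gt0.
Qed.

(** The values below [f k] not taken at the first [k.-1] positions are those taken after position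
    [k]. *)
Lemma missing_fun k : 0 < k <= n ->
  size (missing (f k).-1 [seq f j | j <- iota 1 k.-1]) =
  count (fun j => f j < f k) (iota k.+1 (n - k)).
Proof.
case/andP=> k_gt0 kn; have fk0 : 0 < f k by rewrite f_gt0 ?k_gt0.
have fkn : f k <= n.
  have := perm_mem f_perm (f k).
  by rewrite map_f ?mem_iota ?k_gt0 ?add1n // => /esym/andP[].
pose a v := (v < f k) && (v \notin [seq f j | j <- iota 1 k.-1]).
have -> : size (missing (f k).-1 [seq f j | j <- iota 1 k.-1]) = count a (iota 1 n).
  have -> : iota 1 n = iota 1 (f k).-1 ++ iota (f k) (n - (f k).-1).
    by rewrite -{2}[f k]prednK // -add1n -iotaD subnKC //; lia.
  have a0 : count a (iota (f k) (n - (f k).-1)) = 0.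
    apply/eqP; rewrite -leqn0 leqNgt -has_count; apply/hasPn => v.
    by rewrite mem_iota /a => /andP[vk _]; rewrite ltnNge vk.
  rewrite count_cat a0 addn0 size_filter; apply: eq_in_count => v.
  rewrite mem_iota /a => /andP[_ vk].
  by have -> : v < f k by lia.
rewrite -(seq.permP f_perm) count_map.
have -> : iota 1 n = iota 1 k.-1 ++ k :: iota k.+1 (n - k).
  have -> : k :: iota k.+1 (n - k) = iota (1 + k.-1) (n - k).+1.
    by rewrite add1n prednK.
  by rewrite -iotaD; congr iota; lia.
have a0 : count (preim f a) (iota 1 k.-1) = 0.
  apply/eqP; rewrite -leqn0 leqNgt -has_count; apply/hasPn => j j_k.
  by rewrite /a /= map_f ?andbF.
rewrite count_cat a0 /= {1}/a ltnn !add0n.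
apply: eq_in_count => j; rewrite mem_iota /a => /andP[kj jn] /=.
case: (f j < f k) => //=; apply/mapP => -[i]; rewrite mem_iota => /andP[i0 ik].
by move/f_inj; rewrite !inE => e; have := e _ _; lia.
Qed.

(** A letter before an excedance letter and larger than it is again at an excedance; a letter after
    a non-excedance letter and smaller than it is again at a non-excedance. Hence [den_step] may
    count among all letters. *)
Lemma den_word_fun :
  den_word (rev [seq f k | k <- iota 1 n]) =
  \sum_(k <- iota 1 n | k < f k) k +
  imv_word [seq f k | k <- iota 1 n & k < f k] +
  inv_word [seq f k | k <- iota 1 n & ~~ (k < f k)].
Proof.
pose N m := \sum_(k <- iota 1 m | ~~ (k < f k))
  size (missing (f k).-1 [seq f j | j <- iota 1 k.-1]).
have denE m : m <= n -> den_word (rev [seq f k | k <- iota 1 m]) =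
  \sum_(k <- iota 1 m | k < f k) k +
  imv_word [seq f k | k <- iota 1 m & k < f k] + N m.
  elim: m => [|m IHm] mn.
    by rewrite /N !big_nil imv_wordE /inversions big_ord0.
  rewrite /N iotaS_rcons map_rcons rev_rcons /= IHm 1?ltnW //.
  rewrite /den_step size_rev size_map size_iota /open_exc.
  rewrite [f m.+1 == 0]gtn_eqF ?f_gt0 //=.
  rewrite -cats1 !big_cat !big_cons !big_nil filter_cat map_cat /= -/(N m).
  case: ifP => fm /=; last first.
    have -> : missing (f m.+1).-1 (rev [seq f k | k <- iota 1 m]) =
        missing (f m.+1).-1 [seq f k | k <- iota 1 m].
      by apply: eq_filter => v; rewrite mem_rev.
    by rewrite cats0; lia.
  rewrite !addn0 cats1 !imv_wordE inversions_rcons count_rev.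
  have -> : count (fun x => (x == 0) || (f m.+1 < x)) [seq f k | k <- iota 1 m] =
    count [eta leq (f m.+1)] [seq f k | k <- iota 1 m & k < f k]; last by lia.
  rewrite !count_map count_filter; apply: eq_in_count => k.
  rewrite mem_iota add1n ltnS => /andP[k_gt0 km] /=.
  have kn : k <= n by apply: leq_trans (ltnW mn).
  rewrite gtn_eqF ?f_gt0 ?k_gt0 //=.
  (* The letters are distinct, so the weak inequality of [imv_word] is strict here. *)
  have : f k != f m.+1.
    by apply/eqP => /f_inj; rewrite !inE k_gt0 kn mn => /(_ isT isT); lia.
  by move: fm km; lia.
rewrite denE //; congr (_ + _); rewrite /N inv_wordE.
(* Each inversion is now charged to its left letter, so the induction runs over suffixes instead of
   prefixes. *)
have E m : m <= n ->
  inversions (fun x y => y < x)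
    [seq f k | k <- iota (n - m).+1 m & ~~ (k < f k)] =
   \sum_(k <- iota (n - m).+1 m | ~~ (k < f k))
  size (missing (f k).-1 [seq f j | j <- iota 1 k.-1]).
  elim: m => [|m IHm] mn; first by rewrite /inversions big_nil big_ord0.
  rewrite /= big_cons.
  have e : (n - m.+1).+1 = n - m by lia.
  rewrite e; case: ifP => fk; rewrite ?IHm 1?ltnW //.
  rewrite /= inversions_cons IHm 1?ltnW // addnC; congr (_ + _).
  rewrite missing_fun; last by lia.
  rewrite count_map count_filter; have -> : n - (n - m) = m by lia.
  apply: eq_in_count => j; rewrite mem_iota => /andP[kj _] /=.
  by move: fk; case: (f j < f (n - m)) / (ltnP) => //=; lia.
by have := E n (leqnn n); rewrite subnn => <-.
Qed.

End FunctionWord.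

(** * Windows of signed permutations *)

Definition window n (s : 'B_n) : seq int := [seq sapp s k%:Z | k <- iota 1 n].

Lemma window_inj n : injective (@window n).
Proof.
move=> s s' /eq_in_map ss'.
have pos k : (0 < k <= n)%N -> sapp s k%:Z = sapp s' k%:Z.
  by move=> k_n; apply: ss'; rewrite mem_iota add1n.
have range (j : 'I_n.*2.+1) : - n%:Z <= ord_int j <= n%:Z.
  by have := ltn_ord j; rewrite /ord_int; lia.
have all k : - n%:Z <= k <= n%:Z -> sapp s k = sapp s' k.
  case: (ltgtP k 0) => [k0 kn|k0 kn|->]; last by rewrite !sapp0.
    apply: oppr_inj; rewrite -!sappN //.
    have -> : - k = `|k|%N :> int by lia.
    by apply: pos; lia.
  have -> : k = `|k|%N :> int by lia.
  by apply: pos; lia.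
apply/val_inj/permP => j; apply: (can_inj (@ord_intK n)).
by have := all _ (range j); rewrite /sapp ord_intK.
Qed.

Lemma abs_window n (s : 'B_n) :
  [seq `|x|%N | x <- window s] = [seq `|sapp s k%:Z|%N | k <- iota 1 n].
Proof. by rewrite /window -map_comp. Qed.

Lemma abs_window_perm n (s : 'B_n) : is_signed_word n (window s).
Proof.
rewrite /is_signed_word abs_window.
have -> : iota 1 n = [seq (val i).+1 | i <- enum 'I_n].
  by rewrite map_comp val_enum_ord -[1%N]/(1 + 0)%N iotaDl.
rewrite -map_comp.
rewrite (eq_map (g := fun i => (val (abs_perm s i)).+1)); last first.
  by move=> i /=; rewrite -abs_permE.
rewrite (map_comp (fun i : 'I_n => (val i).+1) (abs_perm s)); apply: perm_map.
apply: uniq_perm; rewrite ?(map_inj_uniq (@perm_inj _ _)) ?enum_uniq //.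
move=> i; rewrite mem_enum; apply/mapP.
by exists ((abs_perm s)^-1%g i); rewrite ?mem_enum ?permKV.
Qed.

Lemma windowP n w : reflect (exists s : 'B_n, window s = w) (is_signed_word n w).
Proof.
apply: (iffP idP) => [w_n|[s <-]]; last exact: abs_window_perm.
have sw : size w = n by move: (perm_size w_n); rewrite size_map size_iota.
have uw : uniq [seq `|x|%N | x <- w] by rewrite (perm_uniq w_n) iota_uniq.
have wi i : (i < n)%N -> (0 < `|(w`_i)%R| <= n)%N.
  move=> i_n; have := perm_mem w_n `|(w`_i)%R|%N.
  by rewrite map_f ?mem_nth ?sw // mem_iota add1n ltnS => /esym.
(* The odd extension of [w]; since [sgz 0] is 0, it sends 0 to 0 whatever the letter read at
   [0.-1]. *)
pose h k := sgz k * w`_(`|k|.-1).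
have hN k : h (- k) = - h k by rewrite /h sgzN abszN mulNr.
have h_abs k : k != 0 -> `|h k|%N = `|(w`_(`|k|.-1))%R|%N.
  by move=> k0; rewrite /h abszM -sgrz absz_sg k0 mul1n.
have h_range k : - n%:Z <= k <= n%:Z -> - n%:Z <= h k <= n%:Z.
  move=> k_n; have [->|k0] := eqVneq k 0; first by rewrite /h sgz0 mul0r; lia.
  by have := h_abs k k0; have := wi `|k|.-1; lia.
have h_inj k l : - n%:Z <= k <= n%:Z -> - n%:Z <= l <= n%:Z -> h k = h l -> k = l.
  move=> k_n l_n.
  have [->|k0] := eqVneq k 0; have [->|l0] := eqVneq l 0 => // hkl.
  - have := h_abs l l0; rewrite -hkl /h sgz0 mul0r; have := wi `|l|.-1; lia.
  - have := h_abs k k0; rewrite hkl /h sgz0 mul0r; have := wi `|k|.-1; lia.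
  have akl : `|k|%N = `|l|%N.
    have := h_abs k k0; rewrite hkl h_abs // => e.
    have := nth_uniq 0%N (i := `|k|.-1) (j := `|l|.-1) _ _ uw.
    rewrite size_map sw !(nth_map 0) ?sw; [|lia|lia].
    by rewrite e eqxx => /(_ _ _)/esym/eqP; lia.
  have w0 : w`_(`|l|.-1) != 0 by have := wi `|l|.-1; lia.
  move: hkl; rewrite /h akl => /(mulIf w0) skl.
  by rewrite [k]intEsg [l]intEsg akl skl.
have range (j : 'I_n.*2.+1) : - n%:Z <= ord_int j <= n%:Z.
  by have := ltn_ord j; rewrite /ord_int; lia.
pose f (j : 'I_n.*2.+1) := int_ord n (h (ord_int j)).
have fE j : ord_int (f j) = h (ord_int j) by rewrite int_ordK // h_range.
have f_inj : injective f.
  move=> i j /(congr1 (@ord_int n)); rewrite !fE => /h_inj e.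
  by apply: (can_inj (@ord_intK n)); apply: e.
have f_rev : [forall j, perm f_inj (rev_ord j) == rev_ord (perm f_inj j)].
  apply/forallP => j; rewrite !permE; apply/eqP/(can_inj (@ord_intK n)).
  by rewrite ord_int_rev !fE ord_int_rev hN.
exists (SignedPerm f_rev); apply: (@eq_from_nth _ 0).
  by rewrite size_map size_iota.
rewrite size_map size_iota => i i_n.
rewrite (nth_map 0%N) ?size_iota // nth_iota // add1n /sapp /= permE fE.
by rewrite int_ordK ?/h //; [rewrite gtr0_sgz // mul1r | lia].
Qed.

(** Allows two enumerations of the same windows: by signs on permutation words, and by insertion of
    the largest letter. *)
Lemma sum_window (R : nmodType) n (F : seq int -> R) (l : seq (seq int)) :
  uniq l -> (forall w, (w \in l) = is_signed_word n w) ->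
  \sum_(s : 'B_n) F (window s) = \sum_(w <- l) F w.
Proof.
move=> u_l l_n; rewrite -(big_map (@window n) predT); apply: perm_big.
apply: uniq_perm => //; first by rewrite (map_inj_uniq (@window_inj n)) index_enum_uniq.
move=> w; rewrite l_n; apply/mapP/windowP => [[s _ ->]|[s <-]]; first by exists s.
by exists s => //; rewrite mem_index_enum.
Qed.

Lemma flag_weight_iota (R : comNzRingType) (q t : R) (f : nat -> int) p m :
  flag_weight q t (f p.+1) p.+1 [seq f k | k <- iota p.+2 m] =
  q ^+ (2 * (\sum_(i <- iota p.+1 m | (f i.+1 < f i)%R) i)
         + count (fun k => f k < 0) (iota p.+2 m)) *
  t ^+ (2 * count (fun i => f i.+1 < f i) (iota p.+1 m)).
Proof.
elim: m p => [|m IHm] p; first by rewrite /= big_nil !expr0 mulr1.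
rewrite [iota _ _]/= map_cons flag_weight_cons IHm /= big_cons.
set a := (\sum_(_ <- _ | _) _)%N; set b := count _ _; set c := count _ _.
by case: ifP => _; case: ifP => _; rewrite /= ?mulnDr ?exprD ?muln1 ?muln0 ?expr0 ?expr1; ring.
Qed.

Lemma flag_weight_window (R : comNzRingType) (q t : R) n (s : 'B_n) :
  (0 < n)%N -> q ^+ fmaj s * t ^+ fdes s = flag_weight q t 0 0 (window s).
Proof.
case: n s => // n s _; rewrite /window [iota _ _]/= map_cons flag_weight_cons.
rewrite (flag_weight_iota q t (fun k => sapp s k%:Z)).
rewrite /fmaj /fdes /maj /neg /des /Neg /Des !size_filter big_filter /index_iota !subSS !subn0.
rewrite [count _ (iota 1 n.+1)]/=.
case: ifP => s1; rewrite /= ?add0n ?addn0 ?mul1r // add1n addn1 addnS !exprS; ring.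
Qed.

(** * Statistics of a signed permutation read off its window *)

Section Link.
Variables (n : nat) (s : 'B_n).
Let f k := `|sapp s k%:Z|%N.

Lemma iota1_enum : iota 1 n = [seq (val i).+1 | i <- enum 'I_n].
Proof. by rewrite map_comp val_enum_ord -[1%N]/(1 + 0)%N iotaDl. Qed.

Lemma letter_abs i : letter (abs_perm s) i = f i.+1.
Proof. exact: abs_permE. Qed.

Lemma sum_Exc (G : nat -> nat) :
  (\sum_(i in Exc (abs_perm s)) G i.+1 = \sum_(k <- iota 1 n | k < f k) G k)%N.
Proof.
rewrite iota1_enum big_map big_enum_cond /=.
by apply: eq_bigl => i; rewrite inE letter_abs.
Qed.

Lemma exc_absE : exc_abs s =
  (exc_word (rev [seq `|x|%N | x <- window s]) + count (fun x => x < 0)%R (window s))%N.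
Proof.
have w_n := abs_window_perm s; rewrite /is_signed_word abs_window in w_n.
rewrite /exc_abs /neg /Neg size_filter abs_window (exc_word_fun w_n) //.
rewrite /index_iota subn1 count_map; congr (_ + _)%N.
by rewrite /exc -sum1_card (sum_Exc (fun=> 1%N)) sum1_count.
Qed.

Lemma denH_absE : denH (abs_perm s) = den_word (rev [seq `|x|%N | x <- window s]).
Proof.
have w_n := abs_window_perm s; rewrite /is_signed_word abs_window in w_n.
rewrite abs_window (den_word_fun w_n) /denH (sum_Exc id).
congr (_ + imv_word _ + inv_word _)%N.
  rewrite /Eword iota1_enum filter_map -map_comp.
  rewrite (eq_filter (a2 := fun i : 'I_n => i.+1 < f i.+1)%N).
    by apply: eq_map => i; rewrite letter_abs.
  by move=> i; rewrite inE letter_abs.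
rewrite /Nword iota1_enum filter_map -map_comp.
rewrite (eq_filter (a2 := fun i : 'I_n => ~~ (i.+1 < f i.+1))%N).
  by apply: eq_map => i; rewrite letter_abs.
by move=> i; rewrite inE letter_abs.
Qed.

Lemma ndenE : `|nden s|%N =
  (den_word (rev [seq `|x|%N | x <- window s])
   + \sum_(x <- window s | (x < 0)%R) `|x|)%N.
Proof.
rewrite -denH_absE big_map /nden /Neg big_filter /index_iota subn1 /= -sumrN.
have -> : \sum_(i <- iota 1 n | sapp s i%:Z < 0) - sapp s i%:Z =
   (\sum_(i <- iota 1 n | (sapp s i%:Z < 0)%R) `|sapp s i%:Z|)%N%:Z.
  rewrite (big_morph Posz PoszD (erefl _)); apply: eq_bigr => i i0.
  by rewrite ltz0_abs.
by rewrite -PoszD.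
Qed.

End Link.

(** * Choice of signs and the product formula *)

Section Signs.
Variable R : comNzRingType.
Implicit Types q t : R.

Fixpoint signings (w : seq nat) : seq (seq int) :=
  if w is x :: w' then [seq y :: v | v <- signings w', y <- [:: x%:Z; - x%:Z]]
  else [:: [::]].

Lemma mem_signings w v : (v \in signings w) = ([seq `|x|%N | x <- v] == w).
Proof.
elim: w v => [|x w IHw] v; first by rewrite inE; case: v.
rewrite /signings -/signings.
apply/allpairsPdep/eqP => [[u [y [u_w y_x ->]]]|].
  rewrite IHw in u_w; rewrite /= (eqP u_w); congr (_ :: _).
  by move: y_x; rewrite !inE; lia.
case: v => [|y v] // [yx vw]; exists v, y; split=> //; first by rewrite IHw vw.
by rewrite !inE; lia.
Qed.

Lemma uniq_signings w : all (leq 1) w -> uniq (signings w).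
Proof.
elim: w => [|x w IHw] // /andP[x0 w0]; rewrite /signings -/signings.
apply: (@allpairs_uniq_dep _ (fun=> int) _ (fun v y => y :: v)).
- exact: IHw.
- by move=> v _; rewrite /= inE andbT; lia.
by move=> [a b] [c d] _ _ /= [-> ->].
Qed.

Definition sign_weight q t (v : seq int) : R :=
  \prod_(x <- v) (if x < 0 then t * q ^+ `|x| else 1).

Lemma sign_weightE q t v : sign_weight q t v =
  q ^+ (\sum_(x <- v | (x < 0)%R) `|x|)%N * t ^+ count (fun x => x < 0) v.
Proof.
rewrite /sign_weight; elim: v => [|x v IHv]; first by rewrite !big_nil !expr0 mulr1.
rewrite !big_cons IHv /=; case: ifP => _; last by rewrite mul1r.
by rewrite add1n exprS exprD; ring.
Qed.

Lemma sum_signings q t w : all (leq 1) w ->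
  \sum_(v <- signings w) sign_weight q t v = \prod_(x <- w) (1 + t * q ^+ x).
Proof.
elim: w => [|x w IHw]; first by rewrite /= big_seq1 /sign_weight !big_nil.
move=> /andP[x0 w0]; rewrite /signings -/signings big_allpairs_dep big_cons -IHw //.
rewrite mulr_sumr; apply: eq_bigr => v _.
rewrite big_cons big_seq1 /sign_weight !big_cons abszN absz_nat.
have -> : (x%:Z < 0) = false by lia.
have -> : (- x%:Z < 0) by lia.
by rewrite mulrDl.
Qed.

Lemma full_partial_word n w :
  is_partial_word n w && (0%N \notin w) = perm_eq w (iota 1 n).
Proof.
apply/andP/idP => [[/and3P[/eqP sw le_w u_w] w0]|w_n].
  have wf : [seq x <- w | x != 0%N] = w.
    by apply/all_filterP/allP => x xw; apply/eqP => x0; rewrite -x0 xw in w0.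
  rewrite wf in u_w; apply: uniq_perm; rewrite ?iota_uniq //.
  have sub : {subset w <= iota 1 n}.
    move=> x xw; rewrite mem_iota add1n ltnS (allP le_w) // andbT lt0n.
    by apply/eqP => x0; rewrite -x0 xw in w0.
  by have [] := uniq_min_size u_w sub _; rewrite ?sw ?size_iota.
rewrite (perm_mem w_n) mem_iota; split=> //; apply/and3P; split.
- by rewrite (perm_size w_n) size_iota.
- by apply/allP => x; rewrite (perm_mem w_n) mem_iota add1n ltnS => /andP[].
by rewrite filter_uniq // (perm_uniq w_n) iota_uniq.
Qed.

Definition full_signed_words n : seq (seq int) :=
  [seq v | w <- [seq w <- partial_words n | 0%N \notin w], v <- signings w].

Lemma mem_full_signed_words n v : (v \in full_signed_words n) = is_signed_word n v.
Proof.
rewrite /is_signed_word -full_partial_word -mem_partial_words andbC.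
rewrite -(mem_filter (fun w : seq nat => 0%N \notin w)).
apply/allpairsPdep/idP => [[w [u [w_n u_w ->]]]|v_n].
  by move: u_w; rewrite mem_signings => /eqP->.
by exists [seq `|x|%N | x <- v], v; rewrite v_n mem_signings eqxx.
Qed.

Lemma uniq_full_signed_words n : uniq (full_signed_words n).
Proof.
apply: (@allpairs_uniq_dep _ (fun=> seq int) _ (fun w v => v)).
- by rewrite filter_uniq ?uniq_partial_words.
- move=> w; rewrite mem_filter => /andP[w0 _]; apply: uniq_signings.
  by apply/allP => x xw; rewrite lt0n; apply/eqP => x0; rewrite -x0 xw in w0.
move=> _ _ /allpairsPdep[w [v [_ v_w ->]]] /allpairsPdep[w' [v' [_ v_w' ->]]] /= vv'.
by rewrite -vv' in v_w' *; move: v_w v_w'; rewrite !mem_signings => /eqP<- /eqP<-.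
Qed.

Definition sign_prod q n t := \prod_(i <- iota 1 n) (1 + t * q ^+ i).

Lemma den_gf_signed q t n :
  \sum_(s : 'B_n) q ^+ `|nden s|%N * t ^+ exc_abs s =
  hist_gf q n 0 t * sign_prod q n t.
Proof.
pose F v := sign_weight q t v * (q ^+ den_word [seq `|x|%N | x <- rev v] *
   t ^+ exc_word [seq `|x|%N | x <- rev v]).
rewrite (eq_bigr (fun s => F (window s))); last first.
  move=> s _; rewrite ndenE exc_absE /F sign_weightE map_rev !exprD.
  by ring.
(* Partial words are stored from the last letter to the first, so windows are enumerated through
   their reversals. *)
rewrite (@sum_window _ _ F (map rev (full_signed_words n))); first last.
- move=> v; rewrite -[v in LHS]revK (mem_map (can_inj revK)) mem_full_signed_words.
  by rewrite /is_signed_word map_rev perm_rev.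
- by rewrite (map_inj_uniq (can_inj revK)) uniq_full_signed_words.
rewrite big_map big_allpairs_dep big_filter /hist_gf mulr_suml big_mkcond.
apply: eq_big_seq => w; rewrite mem_partial_words => w_n.
(* At x = 0 a word with an open position carries a positive power of 0, so only permutation words
   remain. *)
case: ifPn => w0; last first.
  rewrite negbK in w0; have : (0 < count_mem 0%N w)%N by rewrite -has_count has_pred1.
  by case: (count_mem _ _) => // k _; rewrite expr0n mulr0 mulr0 mul0r.
rewrite (count_memPn w0) /qfact big_ord0 expr0 !mulr1.
have {}w_n : perm_eq w (iota 1 n) by rewrite -full_partial_word w_n.
rewrite /sign_prod -(perm_big _ w_n) -sum_signings; last first.
  by apply/allP => x xw; rewrite lt0n; apply/eqP => x0; rewrite -x0 xw in w0.
rewrite mulr_sumr; apply: eq_big_seq => v; rewrite mem_signings => /eqP vw.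
rewrite /F revK vw mulrC; congr (_ * _).
by apply: perm_big; rewrite perm_rev.
Qed.

End Signs.

(** * Comparison of the two recurrences and specialization *)

Lemma hist_gf_flag_gf (R : idomainType) (q t : R) n : q != 0 -> q != 1 ->
  hist_gf q n 0 t * sign_prod q n t = flag_gf q n t.
Proof.
move=> q0 q1; elim: n t => [|n IHn] t.
  by rewrite hist_gf0 /sign_prod big_nil /flag_gf big_seq1 mul1r.
have c0 : 1 - q != 0 by rewrite subr_eq0 eq_sym.
apply: (mulfI c0); rewrite mulrA den_gf_rec // flag_gf_rec -!IHn.
have -> : sign_prod q n (q * t) = \prod_(i <- iota 2 n) (1 + t * q ^+ i).
  rewrite /sign_prod -[2%N]/(1 + 1)%N iotaDl big_map; apply: eq_bigr => i _.
  by rewrite exprS; ring.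
(* The product is split at either end: the first factor goes with the term at [q * t], and the last
   one completes [1 - t * q ^+ n.+1] to [1 - t ^+ 2 * q ^+ (2 * n.+1)]. *)
have pl : sign_prod q n.+1 t = (1 + t * q) * \prod_(i <- iota 2 n) (1 + t * q ^+ i).
  by rewrite /sign_prod big_cons.
have pr : sign_prod q n.+1 t = sign_prod q n t * (1 + t * q ^+ n.+1).
  by rewrite /sign_prod iotaS_rcons -cats1 big_cat big_seq1.
rewrite mulrBl {1}pr pl mulnC exprM; ring.
Qed.

Theorem theorem5p4 (R : comNzRingType) (q t : R) (n : nat) (hn : (1 <= n)%N) :
  \sum_(s : 'B_n) q ^+ `|nden s|%N * t ^+ exc_abs s =
  \sum_(s : 'B_n) q ^+ fmaj s * t ^+ fdes s.
Proof.
(* [f2] is the evaluation in [R] of polynomials over the integers: the inner indeterminate ['X%:P]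
   goes to [q] and the outer one ['X] to [t]. *)
have comm1 : commr_rmorph (intr : int -> R) q by move=> ?; apply: mulrC.
pose f1 := horner_morph comm1.
have comm2 : commr_rmorph f1 t by move=> ?; apply: mulrC.
pose f2 : {rmorphism {poly {poly int}} -> R} := horner_morph comm2.
have fq : f2 'X%:P = q by rewrite /f2 /= horner_morphC; apply: horner_morphX.
have ft : f2 'X = t by apply: horner_morphX.
have q0 : 'X%:P != 0 :> {poly {poly int}} by rewrite polyC_eq0 polyX_eq0.
have q1 : 'X%:P != 1 :> {poly {poly int}}.
  rewrite -polyC1 (inj_eq (@polyC_inj _)); apply/eqP => /(congr1 (fun p : {poly int} => size p)).
  by rewrite size_polyX size_poly1.
have univ : \sum_(s : 'B_n) 'X%:P ^+ `|nden s|%N * 'X ^+ exc_abs s =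
     \sum_(s : 'B_n) 'X%:P ^+ fmaj s * 'X ^+ fdes s :> {poly {poly int}}.
  rewrite den_gf_signed hist_gf_flag_gf // /flag_gf.
  rewrite -(sum_window _ (@uniq_signed_words n) (@mem_signed_words n)).
  by apply: eq_bigr => s _; rewrite flag_weight_window.
have := congr1 f2 univ; rewrite !rmorph_sum.
under eq_bigr do rewrite rmorphM !rmorphXn /= fq ft.
by under [RHS]eq_bigr do rewrite rmorphM !rmorphXn /= fq ft.
Qed.
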